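(* Let $G$ be a countable discrete sofic group with a fixed sofic approximation sequence $\{\sigma_i : G\to \mathrm{Sym}(d_i)\}_{i\in\mathbb{N}}$ (with $\lim_{i\to\infty} d_i=\infty$), acting continuously by homeomorphisms on a compact metric space $(X,\rho)$. Let $\mathcal{U}$ be a finite open cover of $X$. Then $$h(G,\mathcal{U})=\max_{\mu\in\mathcal{M}(X,G)} h_\mu(G,\mathcal{U}),$$ where the right-hand side is set to be $-\infty$ by convention if $\mathcal{M}(X,G)=\emptyset$.
   Context: Sofic approximation sequence: $\mathrm{Sym}(d)$ is the group of permutations of $\{1,\dots,d\}$. The maps (not necessarily homomorphisms) $\sigma_i:G\to\mathrm{Sym}(d_i)$, $g\mapsto\sigma_{i,g}$, satisfy $\lim_{i}\frac{1}{d_i}|\{a\in\{1,\dots,d_i\}:\sigma_{i,st}(a)=\sigma_{i,s}\sigma_{i,t}(a)\}|=1$ for all $s,t\in G$, and $\lim_i\frac{1}{d_i}|\{a:\sigma_{i,s}(a)\ne\sigma_{i,t}(a)\}|=1$ for all distinct $s,t\in G$, and $\lim_i d_i=\infty$. Notation: $\mathcal{F}_Z$ is the set of non-empty finite subsets of a set $Z$. $\mathcal{M}(X)$ is the set of Borel probability measures on $X$, $\mathcal{M}(X,G)$ the subset of $G$-invariant ones; $C(X)$ is the space of real-valued continuous functions on $X$; $\mu(f)=\int_X f\,d\mu$. For a finite cover $\mathcal{V}$ of a set $Y$ and $\emptyset\neq K\subseteq Y$, $N(\mathcal{V},K)$ is the minimal cardinality of a subfamily of $\mathcal{V}$ covering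 $K$; $N(\mathcal{V},\emptyset)=0$. $\mathcal{U}^d=\{U_1\times\cdots\times U_d: U_1,\dots,U_d\in\mathcal{U}\}$. For $F\in\mathcal{F}_G$, $\delta>0$ and a map $\sigma:G\to\mathrm{Sym}(d)$, $g\mapsto\sigma_g$, put $$X^d_{F,\delta,\sigma}=\Big\{(x_1,\dots,x_d)\in X^d:\max_{s\in F}\sqrt{\tfrac1d\textstyle\sum_{i=1}^d\rho^2(sx_i,x_{\sigma_s(i)})}<\delta\Big\},$$ and for $L\in\mathcal{F}_{C(X)}$, $\mu\in\mathcal{M}(X)$, $$X^d_{F,\delta,\sigma,\mu,L}=\Big\{(x_1,\dots,x_d)\in X^d_{F,\delta,\sigma}:\max_{f\in L}\Big|\tfrac1d\textstyle\sum_{i=1}^d f(x_i)-\mu(f)\Big|<\delta\Big\}.$$ For a finite open cover $\mathcal{U}$ of $X$ (convention $\log 0=-\infty$): $h_{F,\delta}(G,\mathcal{U})=\limsup_{i\to\infty}\frac{1}{d_i}\log N(\mathcal{U}^{d_i},X^{d_i}_{F,\delta,\sigma_i})$, $h_{F,\delta,\mu,L}(G,\mathcal{U})=\limsup_{i\to\infty}\frac1{d_i}\log N(\mathcal{U}^{d_i},X^{d_i}_{F,\delta,\sigma_i,\mu,L})$, $h(G,\mathcal{U})=\inf_{F\in\mathcal{F}_G}\inf_{\delta>0}h_{F,\delta}(G,\mathcal{U})$ (topological entropy of $\mathcal{U}$), and $h_\mu(G,\mathcal{U})=\inf_{L\in\mathcal{F}_{C(X)}}\inf_{F\in\mathcal{F}_G}\inf_{\delta>0}h_{F,\delta,\mu,L}(G,\mathcal{U})$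 ($\mu$-measure-theoretic entropy of $\mathcal{U}$). Both may take the value $-\infty$. *)

(* Defs.v *)
From HB Require Import structures.
From mathcomp Require Import all_boot all_order all_algebra perm finmap.
From mathcomp Require Import all_classical all_reals all_analysis.

Set Implicit Arguments.
Unset Strict Implicit.
Unset Printing Implicit Defensive.

Import Order.TTheory GRing.Theory Num.Theory.
Import numFieldNormedType.Exports.

Local Open Scope classical_set_scope.
Local Open Scope ring_scope.

(* The product of permutations in mathcomp is composed left to right, so the
   approximate multiplicativity is stated pointwise. *)
Record sofic_approximation (R : realType) (G : groupType) (d : nat -> nat)
    (sigma : forall i, G -> {perm 'I_(d i)}) : Prop := SoficApproximation {
  sofic_dim : d @ \oo --> \oo ;
  sofic_mul : forall s t : G,
    (d i)%:R^-1
      * #|[pred a | sigma i (s * t)%g a == sigma i s (sigma i t a)]|%:R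
      @[i --> \oo] --> (1 : R) ;
  sofic_free : forall s t : G, s != t ->
    (d i)%:R^-1 * #|[pred a | sigma i s a != sigma i t a]|%:R
      @[i --> \oo] --> (1 : R) }.

(* G is discrete: continuity of the action is continuity of each x |-> g x,
   which is then a homeomorphism with inverse x |-> g^-1 x. *)
Record continuous_action (G : groupType) (X : topologicalType)
    (act : G -> X -> X) : Prop := ContinuousAction {
  act1x : forall x, act 1%g x = x ;
  actMx : forall g h x, act (g * h)%g x = act g (act h x) ;
  act_continuous : forall g, continuous (act g) }.

Record finite_open_cover (X : topologicalType) (U : set (set X)) : Prop :=
  FiniteOpenCover {
  cover_finite : finite_set U ;
  cover_open : U `<=` open ;
  cover_full : \bigcup_(A in U) A = [set: X] }.

Section covering_number.
Variables (T : Type) (V : set (set T)) (K : set T).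

Definition subcover_of_card (n : nat) : Prop :=
  exists W : set (set T),
    [/\ W `<=` V, (W #= `I_n)%card & K `<=` \bigcup_(A in W) A].

(* The default value 0 of xget is only used when no finite subfamily of V
   covers K.  For K empty, the empty subfamily gives the value 0. *)
Definition covering_number : nat :=
  xget 0%N [set n | subcover_of_card n /\
                    forall m, subcover_of_card m -> (n <= m)%N].

End covering_number.

Definition box (X : Type) (d : nat) (A : 'I_d -> set X) : set ('I_d -> X) :=
  [set x | forall a, A a (x a)].

Definition product_cover (X : Type) (U : set (set X)) (d : nat) :
    set (set ('I_d -> X)) :=
  [set box A | A in [set A : 'I_d -> set X | forall a, U (A a)]].

(* Measurable types are pointed in the library.  A Borel probability measure
   is therefore carried with a base point, which plays no other role; for X
   empty there is no such measure, as expected. *)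
Definition pointed_at (X : choiceType) (x0 : X) : Type := X.
HB.instance Definition _ (X : choiceType) (x0 : X) :=
  Choice.on (pointed_at x0).
HB.instance Definition _ (X : choiceType) (x0 : X) :=
  isPointed.Build (pointed_at x0) x0.

Definition borel (X : topologicalType) (x0 : X) :=
  g_sigma_algebraType (open : set (set (pointed_at x0))).

Record borel_probability (R : realType) (X : topologicalType) :=
  BorelProbability {
  base_point : X ;
  bmeasure :> probability (borel base_point) R }.

Definition invariant_probability (R : realType) (G : groupType)
    (X : topologicalType) (act : G -> X -> X) :
    set (borel_probability R X) :=
  [set mu | forall (g : G) (A : set (borel (base_point mu))), measurable A ->
    bmeasure mu (act g @^-1` A) = bmeasure mu A].

Arguments invariant_probability R {G X} act.

Definition bmean (R : realType) (X : topologicalType)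
    (mu : borel_probability R X) (f : X -> R) : R :=
  \int[bmeasure mu]_x f x.

Section entropy.
Variables (R : realType) (G : groupType) (X : metricType R).
Variable act : G -> X -> X.

Section microstates.
Variables (F : {fset G}) (delta : R) (d : nat) (sigma : G -> {perm 'I_d}).

(* All the terms of the maxima below are nonnegative, so that, for F and L
   nonempty, the base value 0 is harmless. *)
Definition microstates : set ('I_d -> X) :=
  [set x | \big[Num.max/0]_(s <- F)
    Num.sqrt (d%:R^-1 * \sum_(a < d) mdist (act s (x a)) (x (sigma s a)) ^+ 2)
    < delta].

Definition microstates_mu (mu : borel_probability R X)
    (L : {fset continuousType X R}) : set ('I_d -> X) :=
  [set x | microstates x /\
    \big[Num.max/0]_(f <- L) `|d%:R^-1 * \sum_(a < d) f (x a) - bmean mu f|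
    < delta].

End microstates.

Variables (d : nat -> nat) (sigma : forall i, G -> {perm 'I_(d i)}).
Variable U : set (set X).

Local Open Scope ereal_scope.

Definition growth_rate (K : forall i, set ('I_(d i) -> X)) : \bar R :=
  limn_esup (fun i => ((d i)%:R^-1)%:E *
    lne (covering_number (@product_cover X U (d i)) (K i))%:R%:E).

Definition h_Fdelta (F : {fset G}) (delta : R) : \bar R :=
  growth_rate (fun i => microstates F delta (@sigma i)).

Definition h_Fdelta_mu (mu : borel_probability R X)
    (L : {fset continuousType X R}) (F : {fset G}) (delta : R) : \bar R :=
  growth_rate (fun i => microstates_mu F delta (@sigma i) mu L).

Definition topological_entropy : \bar R :=
  ereal_inf [set ereal_inf [set h_Fdelta F delta
      | delta in [set delta | (0 < delta)%R]]
    | F in [set F | F != fset0]].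

Definition measure_entropy (mu : borel_probability R X) : \bar R :=
  ereal_inf [set ereal_inf [set ereal_inf [set h_Fdelta_mu mu L F delta
        | delta in [set delta | (0 < delta)%R]]
      | F in [set F | F != fset0]]
    | L in [set L | L != fset0]].

End entropy.

(* m is the maximum of A, with the convention max set0 = -oo; a nonempty A has
   to attain its supremum. *)
Definition is_max (R : realType) (A : set (\bar R)) (m : \bar R) : Prop :=
  (A = set0 -> m = -oo%E) /\ (A !=set0 -> A m /\ ubound A m).

(* Main.v *)
(* Every h_mu is at most h by monotonicity of covering numbers.  Conversely, let
   h > -oo.  Empirical means of microstates live in the compact product of the
   intervals [-B_f, B_f], f in C(X).  Since a finite union of families growing
   slower than h still grows slower than h, compactness gives a functional phi on
   C(X) such that the microstates with mean near phi grow at rate at least h, for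
   all F, delta and L.  In particular phi is a limit of empirical means of
   microstates, hence positive, linear, normalised, and G-invariant because
   |f x - f y| <= e + K rho(x, y)^2.  By the Riesz representation theorem phi is
   integration against an invariant Borel probability mu, and h_mu >= h. *)

Require Import Defs.
From HB Require Import structures.
From mathcomp Require Import all_boot all_order all_algebra perm finmap.
From mathcomp Require Import all_classical all_reals all_analysis.
From mathcomp Require Import measurable_realfun ring lra.
Import Order.TTheory GRing.Theory Num.Theory.
Import numFieldNormedType.Exports.

Local Open Scope classical_set_scope.
Local Open Scope ring_scope.

Set Implicit Arguments.
Unset Strict Implicit.

(** * Covering numbers and growth rates *)

Section covering_number.
Context {T : Type} {V : set (set T)}.
Hypotheses (V_finite : finite_set V) (V_cover : \bigcup_(A in V) A = setT).

(** The finite cover [V] is itself a subcover of [K], so a minimal cardinality exists and the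
    default of [xget] is never reached. *)
Lemma covering_numberP (K : set T) :
  subcover_of_card V K (covering_number V K) /\
  forall m, subcover_of_card V K m -> (covering_number V K <= m)%N.
Proof.
have [n Vn] : exists n, subcover_of_card V K n.
  have [n Vn] := (finite_setP V).1 V_finite.
  by exists n, V; split => //; rewrite V_cover.
have ex : exists n, `[< subcover_of_card V K n >] by exists n; exact/asboolP.
have [m /asboolP mP m_min] := ex_minnP ex.
apply: (@xgetPex _ 0%N [set n | subcover_of_card V K n /\ _]).
by exists m; split => // k kP; exact/m_min/asboolP.
Qed.

Lemma covering_number_le (K L : set T) :
  K `<=` L -> (covering_number V K <= covering_number V L)%N.
Proof.
move=> KL; apply: (covering_numberP K).2.
have [[W [WV Wn LW]] _] := covering_numberP L.
by exists W; split => //; exact: subset_trans LW.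
Qed.

Lemma covering_numberU (K L : set T) :
  (covering_number V (K `|` L) <= covering_number V K + covering_number V L)%N.
Proof.
have [[W1 [W1V W1n KW1]] _] := covering_numberP K.
have [[W2 [W2V W2n LW2]] _] := covering_numberP L.
have W1f : finite_set W1 by apply: sub_finite_set V_finite.
have W2f : finite_set W2 by apply: sub_finite_set V_finite.
have Wf : finite_set (W1 `|` W2) by rewrite finite_setU.
apply: (@leq_trans #|` fset_set (W1 `|` W2)|); last first.
  rewrite fset_setU// (leq_trans (leq_card_fsetU _ _))//.
  by rewrite (card_fset_set W1n) (card_fset_set W2n).
apply: (covering_numberP (K `|` L)).2; exists (W1 `|` W2); split.
- by move=> A [/W1V|/W2V].
- rewrite -[X in (X #= _)%card](fset_setK Wf); exact/card_eq_fsetP.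
- rewrite bigcup_setU; exact: setUSS.
Qed.

Lemma covering_number_set0 : covering_number V set0 = 0%N.
Proof.
apply/eqP; rewrite -leqn0; apply: (covering_numberP set0).2.
by exists set0; split => //; rewrite II0.
Qed.

End covering_number.

Section product_cover.
Context {X : Type} {U : set (set X)}.

Lemma product_cover_finite (d : nat) :
  finite_set U -> finite_set (@product_cover X U d).
Proof.
move=> /finite_fsetP[F ->]; apply: finite_image.
pose e (g : {ffun 'I_d -> F}) : 'I_d -> set X := fun a => val (g a).
apply: (@sub_finite_set _ _ (e @` setT)); last exact/finite_image/finite_finset.
move=> A AU; exists [ffun a => [` AU a ]%fset] => //.
by apply/funext => a; rewrite /e ffunE.
Qed.

Lemma product_cover_full (d : nat) : \bigcup_(A in U) A = setT ->
  \bigcup_(B in @product_cover X U d) B = setT.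
Proof.
move=> UT; apply/seteqP; split => // x _.
have /choice[A AP] (a : 'I_d) : exists B, U B /\ B (x a).
  by have : [set: X] (x a) by []; rewrite -UT => -[B UB Bx]; exists B.
exists (box A); last by move=> a; have [] := AP a.
by exists A => // a; have [] := AP a.
Qed.

End product_cover.

(** * Exponential growth rates of covering numbers *)

Section growth_rate.
Context {R : realType} {X : metricType R} {d : nat -> nat} {U : set (set X)}.
Hypotheses (d_oo : d @ \oo --> \oo) (U_cover : finite_open_cover U).
Implicit Types K L : forall i, set ('I_(d i) -> X).
Local Open Scope ereal_scope.

Let Ud_finite i : finite_set (@product_cover X U (d i)).
Proof. exact/product_cover_finite/cover_finite. Qed.

Let Ud_full i : \bigcup_(B in @product_cover X U (d i)) B = setT.
Proof. exact/product_cover_full/cover_full. Qed.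

Let d_gt0 (n : nat) : \forall i \near \oo, (n < d i)%N.
Proof. exact: d_oo (nbhs_infty_gt n). Qed.

Lemma growth_rate_le K L : (forall i, K i `<=` L i) ->
  growth_rate U K <= growth_rate U L.
Proof.
move=> KL; apply: le_ereal_inf_tmp => _ [V Voo <-]; apply: ereal_inf_le.
exists (ereal_sup ((fun i => ((d i)%:R^-1)%:E *
  lne (covering_number (@product_cover X U (d i)) (K i))%:R%:E) @` V)).
  by exists V.
apply: ge_ereal_sup => _ [i Vi <-]; apply: le_ereal_sup_tmp.
eexists; first by exists i; [exact: Vi|reflexivity].
apply: lee_wpmul2l; first by rewrite lee_fin invr_ge0.
rewrite lee_lne ?in_itv/= ?leey ?lee_fin ?ler0n// ler_nat.
exact: covering_number_le (KL i).
Qed.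

(** With [growth_rate_le_near], this trades the limsup for eventual exponential bounds, where
    covering number 0 is harmless. *)
Lemma growth_rate_lt_near K (h : \bar R) : growth_rate U K < h ->
  exists r : R, r%:E < h /\ \forall i \near \oo,
    ((covering_number (@product_cover X U (d i)) (K i))%:R <= expR ((d i)%:R * r))%R.
Proof.
move=> /ereal_inf_lt[_ [V Voo <-]]; set s := ereal_sup _ => sh.
have [r sr rh] : exists2 r : R, s <= r%:E & r%:E < h.
  move: sh; case: h => [h| |]; case: s => [s| |] // sh.
  - move: sh; rewrite lte_fin => sh; exists ((s + h) / 2)%R.
      by rewrite lee_fin midf_le// ltW.
    by rewrite lte_fin midf_lt.
  - by exists (h - 1)%R; rewrite ?leNye// lte_fin gtrBl.
  - by exists s; rewrite ?ltry.
  - by exists 0%R; rewrite ?ltry ?leNye.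
exists r; split => //; near=> i.
have Vi : V i by near: i.
have di : (0 < (d i)%:R :> R)%R by rewrite ltr0n; near: i; exact: d_gt0.
set N := covering_number _ _; case: (posnP N) => [->|N0]; first exact: expR_ge0.
have NR : (0 < N%:R :> R)%R by rewrite ltr0n.
have : ((d i)%:R^-1)%:E * lne N%:R%:E <= r%:E.
  by apply: le_trans sr; apply: ereal_sup_ubound; exists i.
rewrite lne_EFin// -EFinM lee_fin mulrC ler_pdivrMr// mulrC => lnN.
by rewrite -(lnK NR) ler_expR.
Unshelve. all: by end_near. Qed.

Lemma growth_rate_le_near K (r : R) :
  (\forall i \near \oo,
    ((covering_number (@product_cover X U (d i)) (K i))%:R <= expR ((d i)%:R * r))%R) ->
  growth_rate U K <= r%:E.
Proof.
move=> Kr; have [V Voo VP] : exists2 V, \oo V & forall i, V i -> (0 < d i)%N /\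
    ((covering_number (@product_cover X U (d i)) (K i))%:R <= expR ((d i)%:R * r))%R.
  eexists; last by move=> i; apply.
  by apply: filterS2 (d_gt0 0) Kr => i.
apply: ereal_inf_le; eexists; first by exists V.
apply: ge_ereal_sup => _ [i /VP[di +] <-].
have dR : (0 < (d i)%:R :> R)%R by rewrite ltr0n.
(* For [N = 0] the term is [-oo] only because [d i > 0]: in [\bar R], [0 * -oo] is 0. *)
set N := covering_number _ _; case: (posnP N) => [->|N0].
  by rewrite le0_lneNy// gt0_muleNy ?leNye// lte_fin invr_gt0.
have NR : (0 < N%:R :> R)%R by rewrite ltr0n.
rewrite -[X in (X <= _)%R](lnK NR) ler_expR => lnN.
by rewrite lne_EFin// -EFinM lee_fin mulrC ler_pdivrMr// mulrC.
Qed.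

(** Subadditivity bounds the covering number of the union by [2 * expR (d i * r)]. Raising [r]
    slightly to [r' < h] absorbs the factor 2, since [d i] tends to infinity. *)
Lemma growth_rateU_lt K L (h : \bar R) :
  growth_rate U K < h -> growth_rate U L < h ->
  growth_rate U (fun i => K i `|` L i) < h.
Proof.
move=> /growth_rate_lt_near[r1 [r1h Kr1]] /growth_rate_lt_near[r2 [r2h Lr2]].
pose r := Order.max r1 r2.
have [r' rr' r'h] : exists2 r' : R, (r < r')%R & r'%:E < h.
  have : r%:E < h by rewrite /r; case: (leP r1 r2).
  case: h {r1h r2h} => [h| |]//; last by exists (r + 1)%R; rewrite ?ltry ?ltrDl.
  rewrite lte_fin => rh; exists ((r + h) / 2)%R; rewrite ?midf_lt//.
  by rewrite lte_fin midf_lt.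
apply: le_lt_trans r'h; apply: growth_rate_le_near.
have r'r : (0 < r' - r)%R by rewrite subr_gt0.
(* Once [d i > n], [d i * (r' - r) >= 1], hence [2 <= expR (d i * (r' - r))] by
   [1 + t <= expR t]. *)
have [n nr] : exists n, ((r' - r)^-1 < n%:R)%R.
  by exists (Num.trunc (r' - r)^-1).+1; exact: truncnS_gt.
near=> i.
have Ki : ((covering_number (@product_cover X U (d i)) (K i))%:R
    <= expR ((d i)%:R * r))%R.
  apply: (@le_trans _ _ (expR ((d i)%:R * r1))%R); first by near: i.
  by rewrite ler_expR ler_wpM2l// le_max lexx.
have Li : ((covering_number (@product_cover X U (d i)) (L i))%:R
    <= expR ((d i)%:R * r))%R.
  apply: (@le_trans _ _ (expR ((d i)%:R * r2))%R); first by near: i.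
  by rewrite ler_expR ler_wpM2l// le_max lexx orbT.
have di : (1 <= (d i)%:R * (r' - r))%R.
  rewrite -ler_pdivrMr// mul1r (le_trans (ltW nr))// ler_nat ltnW//.
  by near: i; exact: d_gt0.
rewrite -(subrK r r')%R mulrDr expRD.
apply: (@le_trans _ _ (2 * expR ((d i)%:R * r))%R).
  rewrite mulr2n mulrDl mul1r (le_trans _ (lerD Ki Li))// -natrD ler_nat.
  exact: covering_numberU.
rewrite ler_wpM2r ?expR_ge0// (le_trans _ (expR_ge1Dx _))//.
by rewrite mulr2n lerD2l.
Unshelve. all: by end_near. Qed.

Lemma growth_rate_set0 (h : \bar R) : -oo < h ->
  growth_rate U (fun i => set0 : set ('I_(d i) -> X)) < h.
Proof.
case: h => [h _|_|//]; last first.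
  apply: (@le_lt_trans _ _ 0%:E); last exact: ltry.
  apply: growth_rate_le_near; apply: nearW => i.
  by rewrite covering_number_set0 ?expR_ge0.
apply: (@le_lt_trans _ _ (h - 1)%:E); last by rewrite lte_fin gtrBl.
apply: growth_rate_le_near; apply: nearW => i.
by rewrite covering_number_set0 ?expR_ge0.
Qed.

(** If the sets were empty for all large [i], all those terms would be [-oo]. This is how a lower
    bound on growth yields an actual microstate. *)
Lemma growth_rate_gtNy K : -oo < growth_rate U K ->
  exists i, (0 < d i)%N /\ K i !=set0.
Proof.
move=> Kgt; apply: contrapT => nK.
suff : growth_rate U K = -oo by move: Kgt => /[swap] ->.
apply: eq_ninfty => r; apply: growth_rate_le_near; near=> i.
have -> : K i = set0.
  apply/eqP/negPn/negP => /set0P Ki; apply: nK; exists i; split => //.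
  by near: i; exact: d_gt0.
by rewrite covering_number_set0 ?expR_ge0.
Unshelve. all: by end_near. Qed.

End growth_rate.

(** * Riesz representation on a compact metric space *)

(** A positive normalised linear functional on C(X), encoded as a total function whose axioms
    constrain continuous arguments only. *)
Record state (R : realType) (X : topologicalType) := State {
  state_fun :> (X -> R) -> R ;
  state_lin : forall (c : R) (f g : X -> R), continuous f -> continuous g ->
    state_fun (fun x => f x + c * g x) = state_fun f + c * state_fun g ;
  state_ge0 : forall f : X -> R, continuous f ->
    (forall x, 0 <= f x) -> 0 <= state_fun f ;
  state1 : state_fun (fun=> 1) = 1 }.

(** * States and their outer measures *)

Section state_theory.
Context {R : realType} {X : topologicalType} (phi : state R X).
Implicit Types f g : X -> R.

Let cst_cont (c : R) : continuous (fun _ : X => c).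
Proof. by move=> x; apply: cvg_cst. Qed.

Lemma state_cst0 : phi (fun=> 0) = 0.
Proof.
have := state_lin phi (-1) (@cst_cont 1) (@cst_cont 1).
by rewrite mulN1r subrr mulN1r subrr.
Qed.

Lemma stateD f g : continuous f -> continuous g ->
  phi (fun x => f x + g x) = phi f + phi g.
Proof.
move=> fc gc; rewrite -[phi g]mul1r -state_lin//.
by congr (phi _); apply/funext => x; rewrite mul1r.
Qed.

Lemma stateZ c f : continuous f -> phi (fun x => c * f x) = c * phi f.
Proof.
move=> fc; rewrite -[RHS]add0r -state_cst0 -state_lin//.
by congr (phi _); apply/funext => x; rewrite add0r.
Qed.

Lemma stateB f g : continuous f -> continuous g ->
  phi (fun x => f x - g x) = phi f - phi g.
Proof.
move=> fc gc; rewrite -[- phi g]mulN1r -state_lin//.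
by congr (phi _); apply/funext => x; rewrite mulN1r.
Qed.

Lemma state_cst c : phi (fun=> c) = c.
Proof.
rewrite -[RHS]mulr1 -[in RHS](state1 phi) -stateZ//.
by congr (phi _); apply/funext => x; rewrite mulr1.
Qed.

Lemma le_state f g : continuous f -> continuous g ->
  (forall x, f x <= g x) -> phi f <= phi g.
Proof.
move=> fc gc fg; rewrite -subr_ge0 -stateB//; apply: state_ge0.
  by move=> x; apply: cvgB; [exact: gc|exact: fc].
by move=> x; rewrite subr_ge0.
Qed.

Lemma continuous_sum_ord (n : nat) (F : nat -> X -> R) :
  (forall i, continuous (F i)) -> continuous (fun x => \sum_(i < n) F i x).
Proof.
move=> Fc; elim: n => [|n IH] x.
  by under eq_fun do rewrite big_ord0; exact: cvg_cst.
rewrite (_ : (fun x => _) = (fun x => \sum_(i < n) F i x + F n x)); last first.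
  by apply/funext => y; rewrite big_ord_recr.
by apply: cvgD; [exact: IH|exact: Fc].
Qed.

Lemma state_sum (n : nat) (F : nat -> X -> R) : (forall i, continuous (F i)) ->
  phi (fun x => \sum_(i < n) F i x) = \sum_(i < n) phi (F i).
Proof.
move=> Fc; elim: n => [|n IH].
  rewrite big_ord0 -[RHS]state_cst0; congr (phi _).
  by apply/funext => x; rewrite big_ord0.
rewrite big_ord_recr/= -IH -stateD//; last exact: continuous_sum_ord.
by congr (phi _); apply/funext => x; rewrite big_ord_recr.
Qed.

(* [state_covers A c]: the indicator of A lies below the increasing limit of
   nonnegative continuous functions of mean at most c.  Increasing sequences,
   rather than series, spare double sums in countable subadditivity. *)
Definition state_covers (A : set X) (c : R) :=
  exists f : nat -> X -> R,
    [/\ forall n, continuous (f n), forall n x, 0 <= f n x,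
        forall x m n, (m <= n)%N -> f m x <= f n x,
        forall n, phi (f n) <= c
      & forall x, A x -> exists n, 1 <= f n x].

Lemma state_covers_ge0 A c : state_covers A c -> 0 <= c.
Proof.
move=> [f [fc f0 _ fle _]]; apply: le_trans (fle 0%N); exact: state_ge0.
Qed.

Lemma state_covers1 A : state_covers A 1.
Proof.
exists (fun _ _ => 1); split => //= [n|x _]; last by exists 0%N.
by rewrite state1.
Qed.

(** The real infimum is meaningful: the costs include 1 and are bounded below by 0. *)
Definition state_outer (A : set X) : \bar R := (inf [set c | state_covers A c])%:E.

Lemma state_outer_le A c : state_covers A c -> (state_outer A <= c%:E)%E.
Proof.
move=> Ac; rewrite lee_fin; apply: ge_inf => //.
by exists 0 => x; exact: state_covers_ge0.
Qed.

Lemma state_outer_adherent A (e : R) : 0 < e ->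
  exists2 c, state_covers A c & (c%:E < state_outer A + e%:E)%E.
Proof.
move=> e0; have [|c Ac ce] := @inf_adherent _ [set c | state_covers A c] _ e0.
  split; first by exists 1; exact: state_covers1.
  by exists 0 => x; exact: state_covers_ge0.
by exists c => //; rewrite -EFinD lte_fin.
Qed.

Lemma state_outer_ge0 A : (0 <= state_outer A)%E.
Proof.
rewrite lee_fin; apply: lb_le_inf; first by exists 1; exact: state_covers1.
by move=> c; exact: state_covers_ge0.
Qed.

Lemma state_outer0 : state_outer set0 = 0%E.
Proof.
apply/eqP; rewrite eq_le state_outer_ge0 andbT; apply: state_outer_le.
by exists (fun _ _ => 0); split => // n; rewrite state_cst0.
Qed.

Lemma le_state_outer : {homo state_outer : A B / A `<=` B >-> (A <= B)%E}.
Proof.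
move=> A B AB; apply/lee_addgt0Pr => e e0.
have [c [f [fc f0 fnd fle fB]] ce] := state_outer_adherent B e0.
apply: le_trans (ltW ce); apply: state_outer_le.
by exists f; split => // x /AB /fB.
Qed.

(** Cover each [F m] by an increasing sequence [f m] of cost within [e / 2 ^+ m.+1]. The diagonal
    sums of [f m n] over [m < n] increase with [n] and cover the union. *)
Lemma state_outer_sigma_subadditive : sigma_subadditive state_outer.
Proof.
move=> F; apply/lee_addgt0Pr => e e0.
have e_gt0 n : 0 < e / 2 ^+ n.+1 by rewrite divr_gt0 ?exprn_gt0.
have /choice[c cP] n : exists c, state_covers (F n) c /\
    (c%:E < state_outer (F n) + (e / 2 ^+ n.+1)%:E)%E.
  by have [c ? ?] := state_outer_adherent (F n) (e_gt0 n); exists c.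
have /choice[f fP] n := (cP n).1.
have sum_lt n : (\sum_(i < n) (c i)%:E <= \sum_(i <oo) state_outer (F i) + e%:E)%E.
  apply: (@le_trans _ _ (\sum_(i < n) state_outer (F i) + e%:E))%E; last first.
    rewrite leeD2r// -(big_mkord xpredT (fun i => state_outer (F i))).
    by apply: nneseries_lim_ge => i _ _; exact: state_outer_ge0.
  (* The geometric excess summed up to [n] is exactly [e - e / 2 ^+ n], which makes the induction
     close. *)
  apply: (@le_trans _ _ (\sum_(i < n) state_outer (F i) + (e - e / 2 ^+ n)%:E))%E.
    elim: n => [|n IH]; first by rewrite !big_ord0 expr0 divr1 subrr adde0.
    rewrite !big_ord_recr/=; apply: le_trans (leeD IH (ltW (cP n).2)) _.
    rewrite addeACA -EFinD leeD2l// lee_fin exprS invfM.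
    by lra.
  by rewrite leeD2l// lee_fin gerBl divr_ge0 ?exprn_ge0// ltW.
have [S SE] : exists S : R, (\sum_(i <oo) state_outer (F i) + e%:E)%E = S%:E \/
   (\sum_(i <oo) state_outer (F i) + e%:E)%E = +oo%E.
  have : (0%:E <= \sum_(i <oo) state_outer (F i) + e%:E)%E.
    apply: adde_ge0; last by rewrite lee_fin ltW.
    by apply: nneseries_ge0 => i _ _; exact: state_outer_ge0.
  by case: (\sum_(i <oo) _ + _)%E => // [r|] _; [exists r; left|exists 0; right].
case: SE => SE; last by rewrite SE leey.
rewrite SE; apply: state_outer_le.
exists (fun n x => \sum_(m < n) f m n x); split.
- move=> n; apply: (@continuous_sum_ord n (fun m => f m n)) => m.
  by have [] := fP m.
- by move=> n x; apply: sumr_ge0 => m _; have [_ ->] := fP m.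
- move=> x m n mn; rewrite -(big_mkord xpredT (fun k => f k m x)).
  rewrite -(big_mkord xpredT (fun k => f k n x)).
  rewrite (big_cat_nat (leq0n m) mn)//= -[X in X <= _]addr0; apply: lerD.
    by apply: ler_sum => k _; have [_ _ + _ _] := fP k; apply.
  by apply: sumr_ge0 => k _; have [_ ->] := fP k.
- move=> n; rewrite (@state_sum n (fun m => f m n)); last first.
    by move=> m; have [] := fP m.
  rewrite -lee_fin -SE (le_trans _ (sum_lt n))// sumEFin lee_fin.
  by apply: ler_sum => k _; have [_ _ _ + _] := fP k; apply.
- move=> x [m _ Fmx]; have [_ f0 fnd _ /(_ x Fmx)[n fn1]] := fP m.
  (* Large enough for the [m]-th summand to be present and for [f m] to have reached 1 at [x]. *)
  exists (maxn m.+1 n).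
  rewrite (bigD1 (Ordinal (leq_maxl m.+1 n)))//= -[X in X <= _]addr0; apply: lerD.
    by rewrite (le_trans fn1)// fnd// leq_maxr.
  by apply: sumr_ge0 => k _; have [_ ->] := fP k.
Qed.

HB.instance Definition _ := isOuterMeasure.Build R X state_outer
  state_outer0 state_outer_ge0 le_state_outer state_outer_sigma_subadditive.

(* A cover f_n of A is cut by u_k = min(1, k h), which increases to the
   indicator of {h > 0}: f_n u_n covers the part of A inside, and, for k fixed,
   f_(n+k) (1 - u_k) the part outside. *)
Lemma state_outer_caratheodory (h : X -> R) : continuous h ->
  (forall x, 0 <= h x) -> state_outer.-caratheodory [set x | 0 < h x].
Proof.
move=> hc h0; apply: le_caratheodory_measurable => A.
pose u (k : nat) x : R := Order.min 1 (k%:R * h x).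
have uc k : continuous (u k).
  apply: min_fun_continuous; first exact: cst_cont.
  by move=> x; apply: cvgM; [exact: cvg_cst|exact: hc].
have u0 k x : 0 <= u k x by rewrite le_min ler01 mulr_ge0.
have u1 k x : u k x <= 1 by rewrite ge_min lexx.
have und x m n : (m <= n)%N -> u m x <= u n x.
  by move=> mn; rewrite le_min !ge_min lexx/= ler_wpM2r ?ler_nat ?orbT.
have fuc f k : continuous f -> continuous (fun x => f x * u k x).
  by move=> fc x; apply: cvgM; [exact: fc|exact: uc].
apply/lee_addgt0Pr => e e0; have e20 : 0 < e / 2 by rewrite divr_gt0.
have [c [f [fc f0 fnd fle fA]] ce] := state_outer_adherent A e20.
pose E := [set phi (fun x => f n x * u n x) | n in [set: nat]].
have Es : has_sup E.
  split; first by exists (phi (fun x => f 0%N x * u 0%N x)), 0%N.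
  exists c => _ [n _ <-]; apply: le_trans (fle n); apply: le_state => //.
    exact: fuc.
  by move=> x; rewrite ler_piMr.
(* This [k] is the fixed cut: [f (n + k) * u k] has mean above [sup E - e / 2] for every [n], so
   what remains outside costs at most [c - sup E + e / 2]. *)
have [_ [k _ <-] kE] := sup_adherent e20 Es.
have AO : (state_outer (A `&` [set x | (0 < h x)%R]) <= (sup E)%:E)%E.
  apply: state_outer_le; exists (fun n x => f n x * u n x); split.
  - by move=> n; exact: fuc.
  - by move=> n x; rewrite mulr_ge0.
  - by move=> x m n mn; rewrite ler_pM// ?fnd// und.
  - by move=> n; apply: ub_le_sup; [exact: Es.2|exists n].
  (* Beyond [1 / h x] the cut-off [u] equals 1 at [x]. *)
  - move=> x [/fA[n fn1] hx]; exists (maxn n (Num.trunc (h x)^-1).+1).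
    rewrite [u _ _]min_l ?mulr1; first by rewrite (le_trans fn1)// fnd// leq_maxl.
    rewrite -ler_pdivrMr// mul1r (le_trans (ltW (truncnS_gt _)))// ler_nat.
    exact: leq_maxr.
have AnO : (state_outer (A `&` ~` [set x | (0 < h x)%R]) <= (c - sup E + e / 2)%:E)%E.
  apply: state_outer_le; exists (fun n x => f (n + k)%N x - f (n + k)%N x * u k x).
  have fu n x : f n x - f n x * u k x = f n x * (1 - u k x) by rewrite mulrBr mulr1.
  split.
  - by move=> n x; apply: cvgB; [exact: fc|exact: fuc].
  - by move=> n x; rewrite fu mulr_ge0// subr_ge0.
  - by move=> x m n mn; rewrite !fu ler_wpM2r ?subr_ge0// fnd// leq_add2r.
  - move=> n; rewrite stateB//; last exact: fuc.
    have : phi (fun x => f k x * u k x) <= phi (fun x => f (n + k)%N x * u k x).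
      apply: le_state; [exact: fuc|exact: fuc|move=> x].
      by rewrite ler_wpM2r// fnd// leq_addl.
    by have := fle (n + k)%N; lra.
  - move=> x [/fA[n fn1]] /negP; rewrite -leNgt => hx; exists n.
    have -> : u k x = 0.
      have hx0 : h x = 0 by apply/eqP; rewrite eq_le hx h0.
      by rewrite /u hx0 mulr0 min_r.
    by rewrite mulr0 subr0 (le_trans fn1)// fnd// leq_addr.
apply: le_trans (leeD AO AnO) _; rewrite -EFinD.
apply: (@le_trans _ _ (c%:E + (e / 2)%:E)%E).
  by rewrite -EFinD lee_fin; lra.
rewrite [in leRHS](splitr e) EFinD addeA leeD2r//; exact: ltW.
Qed.

End state_theory.

(** * Borel sets are Caratheodory measurable *)

Section metric_compact.
Context {R : realType} {X : metricType R}.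

(** Take the distance to the complement, which is 1-Lipschitz, and positive on [O] by openness. If
    the complement is empty, take the constant 1. *)
Lemma open_set_positive (O : set X) : open O -> exists h : X -> R,
  [/\ continuous h, forall x, 0 <= h x & O = [set x | 0 < h x]].
Proof.
move=> oO; have [OT|/existsNP[z Oz]] := pselect (forall x, O x).
  exists (fun=> 1); split => //; first by move=> x; exact: cvg_cst.
  by apply/seteqP; split => x _ /=.
pose h x : R := inf [set mdist x y | y in ~` O].
have h_inf x : has_inf [set mdist x y | y in ~` O].
  split; first by exists (mdist x z), z.
  by exists 0 => _ [y _ <-]; exact: mdist_ge0.
have h_le x y : ~ O y -> h x <= mdist x y.
  by move=> Oy; apply: ge_inf; [exact: (h_inf x).2|exists y].
have h_lip x y : h x <= mdist x y + h y.
  rewrite -lerBlDl; apply: lb_le_inf; first exact: (h_inf y).1.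
  move=> _ [w Ow <-]; rewrite lerBlDl (le_trans (h_le _ _ Ow))//.
  exact: metric_triangle.
have h_ge0 x : 0 <= h x.
  by apply: lb_le_inf; [exact: (h_inf x).1|move=> _ [y _ <-]; exact: mdist_ge0].
exists h; split => //.
  move=> x; apply/cvgrPdist_lt => e e0.
  have := nbhsx_ballx x e e0; apply: filterS => y.
  rewrite ballEmdist/= => xy; apply: le_lt_trans xy.
  have := h_lip x y; have := h_lip y x; rewrite (metric_sym y) ler_norml.
  by move=> ? ?; apply/andP; split; lra.
apply/seteqP; split => x /=.
  move=> Ox; have := open_nbhs_nbhs (conj oO Ox).
  rewrite -nbhs_ballE => -[e /= e0 xe]; apply: lt_le_trans e0 _.
  apply: lb_le_inf; first exact: (h_inf x).1.
  move=> _ [y Oy <-]; rewrite leNgt; apply/negP => xy; apply: Oy; apply: xe.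
  by rewrite ballEmdist.
by move=> hx; apply: contrapT => /(h_le x); rewrite mdistxx leNgt hx.
Qed.

End metric_compact.

Section state_measure.
Context {R : realType} {X : metricType R} (phi : state R X) (x0 : X).
Implicit Types f g : X -> R.

(** Caratheodory sets form a sigma-algebra, so open sets suffice; these are the positivity sets of
    nonnegative continuous functions. *)
Lemma borel_caratheodory (A : set (borel x0)) : measurable A ->
  (state_outer phi).-caratheodory A.
Proof.
apply: smallest_sub.
  split.
  - exact: caratheodory_measurable_set0.
  - by move=> B; rewrite setTD; exact: caratheodory_measurable_setC.
  - by move=> F; exact: caratheodory_measurable_bigcup.
by move=> O /open_set_positive[h [hc h0 ->]]; exact: state_outer_caratheodory.
Qed.

Definition state_measure : set (borel x0) -> \bar R := state_outer phi.

Lemma state_measure_sigma_additive : semi_sigma_additive state_measure.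
Proof.
move=> F Fm Ft Fu.
apply: (@caratheodory_measure_sigma_additive R (pointed_at x0) (state_outer phi)) => //.
  by move=> i; exact: borel_caratheodory.
exact: borel_caratheodory.
Qed.

HB.instance Definition _ := isMeasure.Build _ (borel x0) R state_measure
  (state_outer0 phi) (state_outer_ge0 phi) state_measure_sigma_additive.

End state_measure.

(** * Integration against the measure of a state *)

Section riesz.
Context {R : realType} {X : metricType R}.
Hypothesis X_compact : compact [set: X].

(** Every [B] above [|f x| + 1] is a bound near [x]; compactness makes this uniform in [x] for all
    large [B]. *)
Lemma continuous_bounded (f : X -> R) : continuous f ->
  exists2 B, 0 < B & forall x, `|f x| <= B.
Proof.
move=> fc; have : \forall B \near (+oo : set_system R), [set: X] `<=` [set x | `|f x| <= B].
  apply: (compact_near_coveringP _).1 X_compact _ _ _ _ _ => x _.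
  exists (f @^-1` ball (f x) 1, [set B | `|f x| + 1 < B]).
    split; first by apply: fc; exact: nbhsx_ballx.
    exact: nbhs_pinfty_gt.
  move=> [y B] [/= fxy xB]; apply: le_trans (ltW xB).
  rewrite -[f y](subrK (f x)) (le_trans (ler_normD _ _))// addrC lerD2l.
  by rewrite distrC ltW.
move=> H; near (@pinfty_nbhs R) => B; exists B; first by near: B; exact: nbhs_pinfty_gt.
by move=> x; have : [set: X] `<=` [set x | `|f x| <= B]; [near: B|exact].
Unshelve. all: by end_near. Qed.

Variable phi : state R X.

(** Dini's argument: an increasing sequence covering [X] exceeds [1 - e] everywhere from some index
    on, so its cost is at least [1 - e]. *)
Lemma state_outer_setT : state_outer phi setT = 1%:E.
Proof.
apply/eqP; rewrite eq_le state_outer_le; last exact: state_covers1.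
rewrite lee_fin; apply: lb_le_inf; first by exists 1; exact: state_covers1.
move=> c [f [fc f0 fnd fle fT]]; apply/ler_addgt0Pl => e e0.
have : \forall n \near \oo, [set: X] `<=` [set x | 1 - e < f n x].
  apply: (compact_near_coveringP _).1 X_compact _ _ _ _ _ => x _.
  have [n fn1] := fT x I.
  exists (f n @^-1` ball (f n x) e, [set m | (n <= m)%N]).
    split; first by apply: fc; exact: nbhsx_ballx.
    exact: nbhs_infty_ge.
  move=> [y m] [/= + nm]; rewrite /ball/= ltr_distl => /andP[_ +].
  by have := fnd y _ _ nm; lra.
move=> [n _ /(_ n (leqnn n)) fn]; rewrite -lerBlDl (le_trans _ (fle n))//.
rewrite -[X in X <= _](state_cst phi); apply: le_state => //.
  by move=> x; exact: cvg_cst.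
by move=> x; exact/ltW/fn.
Qed.

Variable x0 : X.
Let mu := @state_measure R X phi x0.

Let integrable_continuous (f : X -> R) : continuous f ->
  mu.-integrable setT (EFin \o f).
Proof.
move=> fc; apply: measurable_bounded_integrable => //.
- by have := ltry (1 : R); rewrite -[1%:E]state_outer_setT.
- apply: (measurability _ (RGenOpens.measurableE R)).
  move=> _ [_ [a [b ->] <-]]; rewrite setTI; apply: sub_sigma_algebra.
  by apply: open_comp; [move=> x _; exact: fc|exact: interval_open].
- have [B B0 fB] := continuous_bounded fc.
  by exists B; split; [exact: num_real|] => C /ltW BC x _; exact: le_trans BC.
Qed.

(** The integral of [f] is at most [a * mu A], and the constant sequence [g / a] covers [A] at cost
    [phi g / a]. *)
Let integral_step (a : R) (A : set X) (f g : X -> R) : 0 < a -> open (~` A) ->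
  continuous f -> continuous g -> (forall x, 0 <= f x <= a) ->
  (forall x, ~ A x -> f x = 0) -> (forall x, 0 <= g x) ->
  (forall x, A x -> g x = a) -> \int[mu]_x f x <= phi g.
Proof.
move=> a0 Aopen fc gc f0a fA g0 gA.
have mA : measurable (A : set (borel x0)).
  by rewrite -[A]setCK; apply: measurableC; exact: sub_sigma_algebra.
have muA : (mu A <= (a^-1 * phi g)%:E)%E.
  apply: state_outer_le; exists (fun _ x => a^-1 * g x); split => //.
  - by move=> _ x; apply: cvgM; [exact: cvg_cst|exact: gc].
  - by move=> _ x; rewrite mulr_ge0// invr_ge0 ltW.
  - by move=> _; rewrite stateZ.
  - by move=> x /gA ->; exists 0%N; rewrite mulVf ?gt_eqF.
have f_indic : (\int[mu]_x (f x)%:E <= \int[mu]_x (a%:E * (\1_A x)%:E))%E.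
  apply: ge0_le_integral => //.
  - by move=> x _; rewrite lee_fin; case/andP: (f0a x).
  - exact: measurable_int (integrable_continuous fc).
  - by apply: measurable_funeM; apply/measurable_EFinP; exact: measurable_indic.
  move=> x _; rewrite -EFinM lee_fin indicE.
  case: (pselect (A x)) => Ax; first by rewrite mem_set// mulr1; case/andP: (f0a x).
  by rewrite memNset// mulr0 fA.
have : (\int[mu]_x (f x)%:E <= (phi g)%:E)%E.
  apply: le_trans f_indic _; rewrite ge0_integralZl_EFin//; last 2 first.
  - by apply/measurable_EFinP; exact: measurable_indic.
  - exact: ltW.
  rewrite integral_indic// setIT; have a_ge0 : (0 <= a%:E)%E by rewrite lee_fin ltW.
  apply: le_trans (lee_wpmul2l a_ge0 muA) _.
  by rewrite -EFinM lee_fin mulrA mulfV ?mul1r ?gt_eqF.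
have := integrable_fin_num measurableT (integrable_continuous fc).
by rewrite /Rintegral/= => /fineK <-; rewrite lee_fin.
Qed.

Let min_continuous_cst (f : X -> R) (a : R) : continuous f ->
  continuous (fun x => Order.min (f x) a).
Proof.
by move=> fc; apply: min_fun_continuous => // x; exact: cvg_cst.
Qed.

(* The slice min(f, (n+1)a) - min(f, na) has integral at most a mu{f >= na},
   hence at most the phi-value of the slice below, which equals a on {f >= na}. *)
Let integral_min (f : X -> R) (a : R) (n : nat) : 0 < a -> continuous f ->
  (forall x, 0 <= f x) ->
  \int[mu]_x Order.min (f x) (n.+1%:R * a)
    <= a + phi (fun x => Order.min (f x) (n%:R * a)).
Proof.
move=> a0 fc f0; have mc k := min_continuous_cst (a := k%:R * a) fc.
elim: n => [|n IH].
  (* For [n = 0] the truncation on the right vanishes, and the constant [a] dominates on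
     [A = setT]. *)
  rewrite -[X in X + _](state_cst phi) -stateD//; last by move=> x; exact: cvg_cst.
  apply: (@integral_step a setT) => //.
  - by rewrite setCT; exact: open0.
  - by move=> x; apply: cvgD; [exact: cvg_cst|exact: mc].
  - by move=> x; rewrite mul1r le_min f0 ltW//= ge_min lexx orbT.
  - by move=> x /(_ I).
  - by move=> x; rewrite mul0r min_r// addr0 ltW.
  - by move=> x _; rewrite mul0r min_r// addr0.
pose g k x : R := Order.min (f x) (k.+1%:R * a) - Order.min (f x) (k%:R * a).
have gc k : continuous (g k) by move=> x; apply: cvgB; exact: mc.
have step_a k : k.+1%:R * a = k%:R * a + a by rewrite -natr1 mulrDl mul1r.
have g_int : \int[mu]_x g n.+1 x <= phi (g n).
  apply: (@integral_step a [set x | n.+1%:R * a <= f x]) => //.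
  - rewrite (_ : ~` _ = f @^-1` [set y | y < n.+1%:R * a]).
      by apply: open_comp; [move=> x _; exact: fc|exact: open_lt].
    by apply/seteqP; split => x /=; [move/negP; rewrite -ltNge|rewrite leNgt => ->].
  - move=> x; rewrite /g (step_a n.+1); move: (n.+1%:R * a) => b.
    by rewrite !minElt; case: ifP; case: ifP => *; apply/andP; split; lra.
  - move=> x /= /negP; rewrite -ltNge => /ltW fx.
    by rewrite /g !min_l ?subrr// (le_trans fx)// (step_a n.+1) lerDl ltW.
  - move=> x; rewrite subr_ge0 le_min !ge_min lexx/= step_a lerDl.
    by rewrite (ltW a0) orbT.
  - move=> x /= fx; rewrite /g !min_r//; first by rewrite step_a addrAC subrr add0r.
    by rewrite (le_trans _ fx)// step_a lerDl ltW.
have -> : phi (fun x => Order.min (f x) (n.+1%:R * a)) =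
    phi (fun x => Order.min (f x) (n%:R * a)) + phi (g n).
  by rewrite -stateD//; congr (phi _); apply/funext => x; rewrite addrC subrK.
rewrite addrA; apply: le_trans (lerD IH g_int).
rewrite -RintegralD//; [|exact: integrable_continuous..].
rewrite le_eqVlt; apply/orP; left; apply/eqP.
by apply: eq_Rintegral => x _; rewrite /g addrC subrK.
Qed.

(** Choosing [n * a >= 1] makes both truncations in [integral_min] inactive and leaves the
    arbitrarily small error [a]. *)
Let integral_le_state (f : X -> R) : continuous f ->
  (forall x, 0 <= f x <= 1) -> \int[mu]_x f x <= phi f.
Proof.
move=> fc f01; apply/ler_addgt0Pl => a a0.
have f0 x : 0 <= f x by case/andP: (f01 x).
pose n := (Num.trunc a^-1).+1.
have na : 1 <= n%:R * a by rewrite -ler_pdivrMr// mul1r ltW// truncnS_gt.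
have := integral_min n a0 fc f0.
have -> : (fun x => Order.min (f x) (n%:R * a)) = f.
  by apply/funext => x; rewrite min_l// (le_trans _ na)//; case/andP: (f01 x).
apply: le_trans; rewrite le_eqVlt; apply/orP; left; apply/eqP.
apply: eq_Rintegral => x _; rewrite min_l// (@le_trans _ _ 1)//.
  by case/andP: (f01 x).
by rewrite (le_trans na)// ler_wpM2r ?ler_nat// ltW.
Qed.

(** For values in [0, 1], apply the upper bound to both [g] and [1 - g]. A bounded [f] reduces to
    this case by an affine rescaling. *)
Let integral_state (f : X -> R) : continuous f -> \int[mu]_x f x = phi f.
Proof.
have cst_cont (c : R) : continuous (fun _ : X => c) by move=> x; exact: cvg_cst.
have integral_cst (c : R) : \int[mu]_x c = c.
  have muT : fine (mu setT) = 1 by exact: congr1 state_outer_setT.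
  by rewrite Rintegral_cst// [X in _ * X]muT mulr1.
have unit_case (g : X -> R) : continuous g -> (forall x, 0 <= g x <= 1) ->
    \int[mu]_x g x = phi g.
  move=> gc g01; apply/eqP; rewrite eq_le integral_le_state//=.
  have gc' : continuous (fun x => 1 - g x).
    by move=> x; apply: cvgB; [exact: cvg_cst|exact: gc].
  have := integral_le_state gc'; rewrite stateB// state_cst.
  rewrite RintegralB//; [|exact: integrable_continuous..].
  rewrite integral_cst lerD2l lerN2; apply => x; have := g01 x; lra.
move=> fc; have [B B0 fB] := continuous_bounded fc.
pose g x := (B *+ 2)^-1 * (f x + B).
have B2 : 0 < B *+ 2 by rewrite pmulrn_lgt0.
have fBc : continuous (fun x => f x + B).
  by move=> x; apply: cvgD; [exact: fc|exact: cvg_cst].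
have gc : continuous g by move=> x; apply: cvgM; [exact: cvg_cst|exact: fBc].
have fE : f = (fun x => B *+ 2 * g x - B).
  by apply/funext => x; rewrite /g mulrA mulfV ?gt_eqF// mul1r addrK.
have Bgc : continuous (fun x => B *+ 2 * g x).
  by move=> x; apply: cvgM; [exact: cvg_cst|exact: gc].
rewrite fE stateB// stateZ// state_cst.
rewrite RintegralB//; [|exact: integrable_continuous..].
rewrite RintegralZl//; last exact: integrable_continuous.
rewrite integral_cst unit_case// => x.
rewrite mulr_ge0 ?invr_ge0 ?(ltW B2)//=; last first.
  by have := fB x; rewrite ler_norml; lra.
by rewrite ler_pdivrMl// mulr1 mulr2n lerD2r; have := fB x; rewrite ler_norml; lra.
Qed.

(** The formula for [P] is exported because invariance is checked on the outer measure. *)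
Lemma riesz : exists P : probability (borel x0) R,
  (forall A, P A = state_outer phi A) /\
  forall f : X -> R, continuous f -> \int[P]_x f x = phi f.
Proof.
pose P : probability (borel x0) R := HB.pack (@state_measure R X phi x0)
  (Measure_isProbability.Build _ (borel x0) R (@state_measure R X phi x0)
    state_outer_setT).
by exists P; split => // f; exact: integral_state.
Qed.

End riesz.

(** * Microstates and limit means *)

Lemma bigmax0_ltP (R : realType) (I : eqType) (r : seq I) (F : I -> R) (m : R) :
  \big[Num.max/0]_(i <- r) F i < m <->
  0 < m /\ forall i, i \in r -> F i < m.
Proof.
elim: r => [|i r IH]; first by rewrite big_nil; split => [|[]].
rewrite big_cons gt_max; split.
  move=> /andP[Fi /IH[m0 Fr]]; split => // j; rewrite inE => /predU1P[->//|].
  exact: Fr.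
move=> [m0 Fr]; rewrite Fr ?mem_head//=; apply/IH; split => // j jr.
by apply: Fr; rewrite inE jr orbT.
Qed.

(** Microstates control mean squared distances, so a quadratic bound can be averaged directly. Near
    the diagonal [e] suffices by continuity; away from it the distance is bounded below and a large
    [C] beats the oscillation of [f]. *)
Lemma quadratic_modulus (R : realType) (X : metricType R) (f : X -> R) (e : R) :
  compact [set: X] -> continuous f -> 0 < e ->
  exists2 C, 0 < C & forall x y, `|f x - f y| <= e + C * mdist x y ^+ 2.
Proof.
move=> X_compact fc e0; have [B B0 fB] := continuous_bounded X_compact fc.
have XX_compact : compact [set: X * X].
  by rewrite -setXTT; exact: compact_setX.
have : \forall C \near @pinfty_nbhs R,
    [set: X * X] `<=` [set z | `|f z.1 - f z.2| <= e + C * mdist z.1 z.2 ^+ 2].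
  apply: (compact_near_coveringP _).1 XX_compact _ _ _ _ _ => -[x y] _.
  have [<-|xy] := eqVneq x y.
    exists ([set z | ball (f x) (e / 2) (f z.1) /\ ball (f x) (e / 2) (f z.2)],
            [set C | 0 < C]).
      split; last exact: nbhs_pinfty_gt.
      exists (f @^-1` ball (f x) (e / 2), f @^-1` ball (f x) (e / 2)) => //.
      by split; apply: fc; apply: nbhsx_ballx; rewrite divr_gt0.
    move=> [[x' y'] C] [/= [xx' xy'] C0].
    apply: (@le_trans _ _ e); last first.
      by rewrite lerDl mulr_ge0 ?(ltW C0)// exprn_ge0// mdist_ge0.
    move: xx' xy'; rewrite /ball/= !ltr_distl => /andP[? ?] /andP[? ?].
    by rewrite ler_norml; apply/andP; split; lra.
  (* With a third of the distance, points of the two [r]-balls stay at least [r] apart. *)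
  pose r := mdist x y / 3; have r0 : 0 < r by rewrite divr_gt0// mdist_gt0.
  exists (ball x r `*` ball y r, [set C | B *+ 2 / r ^+ 2 < C]).
    split; last by apply: nbhs_pinfty_gt; exact: num_real.
    by exists (ball x r, ball y r) => //; split; exact: nbhsx_ballx.
  move=> [[x' y'] C] [/= [xx' yy'] CB].
  have rxy : r <= mdist x' y'.
    move: xx' yy'; rewrite !ballEmdist/= => xx' yy'.
    have := metric_triangle x x' y; have := metric_triangle x' y' y.
    rewrite (metric_sym y' y); have -> : mdist x y = r *+ 3.
      by rewrite /r -mulr_natr divfK// pnatr_eq0.
    by rewrite !mulrS mulr0n; lra.
  have fxy : `|f x' - f y'| <= B *+ 2.
    by rewrite (le_trans (ler_normB _ _))// mulr2n lerD.
  apply: le_trans fxy _; apply: (@le_trans _ _ (C * r ^+ 2)).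
    by rewrite -ler_pdivrMr ?exprn_gt0// ltW.
  rewrite -[leLHS]add0r lerD ?(ltW e0)// ler_wpM2l//.
    apply: le_trans (ltW CB); rewrite divr_ge0 ?exprn_ge0 ?(ltW r0)//.
    by rewrite mulrn_wge0// ltW.
  by rewrite lerXn2r// ?nnegrE ?mdist_ge0 ?(ltW r0).
move=> H; near (@pinfty_nbhs R) => C; exists C.
  by near: C; exact: nbhs_pinfty_gt.
move=> x y; have /(_ (x, y) I)// : [set: X * X] `<=`
  [set z | `|f z.1 - f z.2| <= e + C * mdist z.1 z.2 ^+ 2] by near: C.
Unshelve. all: by end_near. Qed.

(** Composing a covering sequence of [A] with [T] covers the preimage at the same cost. *)
Lemma le_state_outer_preimage (R : realType) (X : topologicalType)
    (phi : state R X) (T : X -> X) (A : set X) : continuous T ->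
  (forall f : X -> R, continuous f -> phi (f \o T) = phi f) ->
  (state_outer phi (T @^-1` A) <= state_outer phi A)%E.
Proof.
move=> Tc phiT; apply/lee_addgt0Pr => e e0.
have [c [f [fc f0 fnd fle fA]] ce] := state_outer_adherent phi A e0.
apply: le_trans (ltW ce); apply: state_outer_le.
exists (fun n => f n \o T); split => //=.
- by move=> n x; apply: continuous_comp; [exact: Tc|exact: fc].
- by move=> x m n; exact: fnd.
- by move=> n; rewrite phiT.
- by move=> x /fA.
Qed.

(** * The limit functional obtained from microstates *)

Section entropy.
Context {R : realType} {G : groupType} {X : metricType R}.
Variables (act : G -> X -> X) (d : nat -> nat).
Variables (sigma : forall i, G -> {perm 'I_(d i)}) (U : set (set X)).
Hypotheses (d_oo : d @ \oo --> \oo) (U_cover : finite_open_cover U).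
Hypotheses (X_compact : compact [set: X]) (act_cont : continuous_action act).

Let C := continuousType X R.
Let h := topological_entropy act sigma U.

Definition empirical_mean (n : nat) (x : 'I_n -> X) (f : X -> R) : R :=
  n%:R^-1 * \sum_(a < n) f (x a).

Lemma le_microstates (F F' : {fset G}) (delta delta' : R) i :
  (F `<=` F')%fset -> delta' <= delta ->
  microstates act F' delta' (@sigma i) `<=` microstates act F delta (@sigma i).
Proof.
move=> /fsubsetP FF' dd' x /bigmax0_ltP[d0 xF]; apply/bigmax0_ltP; split.
  exact: lt_le_trans dd'.
by move=> s /FF' /xF /lt_le_trans; apply.
Qed.

Lemma measure_entropy_le (mu : borel_probability R X) :
  (measure_entropy act sigma U mu <= h)%E.
Proof.
have zero_cont : continuous (fun _ : X => 0 : R) by move=> x; exact: cvg_cst.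
pose c0 : C := mkcts zero_cont.
apply: le_ereal_inf_tmp => _ [F F0 <-]; apply: le_ereal_inf_tmp => _ [delta delta0 <-].
apply: ereal_inf_le; eexists.
  by exists [fset c0]%fset => //=; apply/fset0Pn; exists c0; rewrite inE.
apply: ereal_inf_le; eexists; first by exists F.
apply: ereal_inf_le; eexists; first by exists delta.
by apply: (growth_rate_le U_cover) => i x [].
Qed.

(* The complements of slow sets form a filter on the compact cube containing all
   empirical means; a cluster point of it has no slow neighbourhood. *)
Definition slow (S : set (C -> R)) := exists F delta,
  [/\ F != fset0, 0 < delta &
    (growth_rate U (fun i => [set x | microstates act F delta (@sigma i) x /\
       S (fun f : C => empirical_mean x f)]) < h)%E].

Lemma slowS (S T : set (C -> R)) : S `<=` T -> slow T -> slow S.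
Proof.
move=> ST [F [delta [F0 d0 grow]]]; exists F, delta; split => //.
apply: le_lt_trans grow; apply: (growth_rate_le U_cover) => i x [xF /ST Tx].
by split.
Qed.

Lemma slowU (S T : set (C -> R)) : slow S -> slow T -> slow (S `|` T).
Proof.
move=> [F [delta [F0 d0 grow]]] [F' [delta' [F'0 d'0 grow']]].
exists (F `|` F')%fset, (Num.min delta delta'); split.
- by case/fset0Pn: F0 => s sF; apply/fset0Pn; exists s; rewrite inE sF.
- by rewrite lt_min d0.
have := growth_rateU_lt d_oo U_cover grow grow'.
apply: le_lt_trans; apply: (growth_rate_le U_cover) => i x [xF [Sx|Tx]].
- left; split => //; apply: le_microstates xF; first exact: fsubsetUl.
  by rewrite ge_min lexx.
- right; split => //; apply: le_microstates xF; first exact: fsubsetUr.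
  by rewrite ge_min lexx orbT.
Qed.

Hypothesis h_gtNy : (-oo < h)%E.

(** No microstate has its mean in [S], so the growth rate is that of the empty set; this is where
    [h > -oo] enters. *)
Lemma slow_disjoint (S : set (C -> R)) :
  (forall n (x : 'I_n -> X), ~ S (fun f : C => empirical_mean x f)) -> slow S.
Proof.
move=> S0; exists [fset 1%g]%fset, 1; split => //.
  by apply/fset0Pn; exists 1%g; rewrite inE.
apply: le_lt_trans (growth_rate_set0 (d := d) d_oo U_cover h_gtNy).
by apply: (growth_rate_le U_cover) => i x [_ /S0].
Qed.

Lemma not_slow_setT : ~ slow setT.
Proof.
move=> [F [delta [F0 d0]]]; apply/negP; rewrite -leNgt.
apply: (@le_trans _ _ (h_Fdelta act sigma U F delta)); last first.
  by apply: (growth_rate_le U_cover) => i x.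
apply: ereal_inf_le; eexists; first by exists F.
by apply: ereal_inf_le; eexists; first by exists delta.
Qed.

Lemma limit_mean : exists phi : {ptws C -> R}, forall S, nbhs phi S -> ~ slow S.
Proof.
have /choice[B BP] (f : C) : exists B, 0 < B /\ forall x, `|f x| <= B.
  have [B ? ?] := continuous_bounded X_compact (@cts_fun _ _ f).
  by exists B.
have cube_compact : compact [set phi : {ptws C -> R} | forall f, phi f \in `[- B f, B f]].
  apply: (@tychonoff C (fun=> R) (fun f => [set` `[- B f, B f]])) => f.
  exact: segment_compact.
pose fast : set_system {ptws C -> R} := [set S | slow (~` S)].
have fast_filter : ProperFilter fast.
  split; first by rewrite /fast/= setC0; exact: not_slow_setT.
  split.
  - by apply: slow_disjoint => n x; apply.
  - by move=> S T; rewrite /fast/= setCI; exact: slowU.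
  - by move=> S T ST; apply: slowS; exact: subsetC.
have [|phi [_ phiP]] := cube_compact fast fast_filter.
  (* The cube belongs to the filter because its complement contains no empirical mean. *)
  apply: slow_disjoint => n x; apply => f /=; rewrite in_itv/= -ler_norml.
  rewrite normrM ger0_norm ?invr_ge0//.
  case: n x => [|n] x; first by rewrite big_ord0 normr0 mulr0 ltW// (BP f).1.
  rewrite ler_pdivrMl// (le_trans (ler_norm_sum _ _ _))//.
  apply: (@le_trans _ _ (\sum_(a < n.+1) B f)).
    by apply: ler_sum => a _; exact: (BP f).2.
  by rewrite sumr_const card_ord mulr_natl.
(* If [S] were slow, its complement would lie in the filter and would have to meet the neighbourhood
   [S]. *)
exists phi => S phiS S_slow; have [|psi []] := phiP (~` S) S _ phiS; last by [].
by rewrite /fast/= setCK.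
Qed.

(** * The limit functional is an invariant state *)

Section limit_state.
Variable phi : {ptws C -> R}.
Hypothesis phiP : forall S, nbhs phi S -> ~ slow S.

Lemma nbhs_means (L : seq C) (e : R) : 0 < e ->
  \forall psi \near phi, forall f, f \in L -> `|psi f - phi f| < e.
Proof.
have nbhs_phi : Filter (nbhs phi) := nbhs_filter phi.
move=> e0; elim: L => [|f L IH].
  by apply: (@filterS _ _ nbhs_phi setT) => //; exact: filterT.
have phif : \forall psi \near phi, `|phi f - psi f| < e.
  have : (fun psi : {ptws C -> R} => psi f) @ phi --> phi f.
    exact: (@proj_continuous C (fun=> R) f phi).
  by move/cvgrPdist_lt; apply.
apply: filterS2 phif IH => psi psif psiL g; rewrite inE => /predU1P[->|/psiL//].
by rewrite distrC.
Qed.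

Lemma growth_rate_limit_mean (F : {fset G}) (delta : R) (L : seq C) :
  F != fset0 -> 0 < delta ->
  (h <= growth_rate U (fun i => [set x |
    microstates act F delta (@sigma i) x /\
    forall f, f \in L -> (`|empirical_mean x f - phi f| < delta)%R]))%E.
Proof.
move=> F0 d0; rewrite leNgt; apply/negP => grow; apply: (phiP (nbhs_means L d0)).
by exists F, delta.
Qed.

(** Growth above [-oo] forces genuine microstates with mean near [phi]; the properties of [phi] are
    read off from them. *)
Lemma limit_mean_microstate (s : G) (delta : R) (L : seq C) : 0 < delta ->
  exists i (x : 'I_(d i) -> X), [/\ (0 < d i)%N,
    microstates act [fset s]%fset delta (@sigma i) x
    & forall f, f \in L -> `|empirical_mean x f - phi f| < delta].
Proof.
move=> d0; have s0 : [fset s]%fset != fset0 by apply/fset0Pn; exists s; rewrite inE.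
have := lt_le_trans h_gtNy (growth_rate_limit_mean L s0 d0).
by move=> /(growth_rate_gtNy d_oo U_cover)[i [di [x [xs xL]]]]; exists i, x.
Qed.

(** Bridges [phi], defined on bundled continuous functions, and [state], which takes plain ones. *)
Definition limit_fun (f : X -> R) : R :=
  if pselect (continuous f) is left fc then phi (mkcts fc) else 0.

Lemma limit_funE (f : X -> R) (fc : continuous f) : limit_fun f = phi (mkcts fc).
Proof.
rewrite /limit_fun; case: pselect => // fc'.
by congr (phi _); apply/continuousEP.
Qed.

Lemma limit_fun_microstate (s : G) (delta : R) (f g k : X -> R) : 0 < delta ->
  continuous f -> continuous g -> continuous k ->
  exists i (x : 'I_(d i) -> X), [/\ (0 < d i)%N,
    microstates act [fset s]%fset delta (@sigma i) x,
    `|empirical_mean x f - limit_fun f| < delta,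
    `|empirical_mean x g - limit_fun g| < delta
    & `|empirical_mean x k - limit_fun k| < delta].
Proof.
move=> d0 fc gc kc.
have [i [x [di xs xL]]] := limit_mean_microstate s
  [:: (mkcts fc : C); (mkcts gc : C); (mkcts kc : C)] d0.
exists i, x; split => //.
- by rewrite (limit_funE fc); apply: (xL (mkcts fc)); rewrite !inE eqxx.
- by rewrite (limit_funE gc); apply: (xL (mkcts gc)); rewrite !inE eqxx orbT.
- by rewrite (limit_funE kc); apply: (xL (mkcts kc)); rewrite !inE eqxx !orbT.
Qed.

Let eq_close (a b : R) : (forall e, 0 < e -> `|a - b| <= e) -> a = b.
Proof.
move=> ab; apply/eqP; rewrite -subr_eq0 -normr_le0.
by apply/ler_addgt0Pl => e /ab; rewrite addr0.
Qed.

Let limit_fun_lin (c : R) (f g : X -> R) : continuous f -> continuous g ->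
  limit_fun (fun x => f x + c * g x) = limit_fun f + c * limit_fun g.
Proof.
move=> fc gc; apply: eq_close => e e0.
have fgc : continuous (fun x => f x + c * g x).
  by move=> x; apply: cvgD; [exact: fc|apply: cvgM; [exact: cvg_cst|exact: gc]].
have c0 : 0 < 2 + `|c| by rewrite ltr_wpDr.
(* Three approximation errors, weighted 1, 1 and [|c|], add up to [e]. *)
have [i [x [di _ xf xg xfg]]] := limit_fun_microstate 1%g (divr_gt0 e0 c0) fc gc fgc.
have mean_lin : empirical_mean x (fun x => f x + c * g x) =
    empirical_mean x f + c * empirical_mean x g.
  by rewrite /empirical_mean big_split/= mulrDr -mulr_sumr mulrCA.
have -> : e = e / (2 + `|c|) + (e / (2 + `|c|) + `|c| * (e / (2 + `|c|))).
  by field; rewrite gt_eqF.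
rewrite [X in `|X|](_ : _ =
    - (empirical_mean x (fun x => f x + c * g x) - limit_fun (fun x => f x + c * g x))
    + ((empirical_mean x f - limit_fun f) + c * (empirical_mean x g - limit_fun g))).
  rewrite (le_trans (ler_normD _ _))// normrN lerD ?(ltW xfg)//.
  rewrite (le_trans (ler_normD _ _))// lerD ?(ltW xf)// normrM ler_wpM2l//.
  exact: ltW.
by rewrite mean_lin; ring.
Qed.

Let limit_fun_ge0 (f : X -> R) : continuous f -> (forall x, 0 <= f x) ->
  0 <= limit_fun f.
Proof.
move=> fc f0; rewrite leNgt; apply/negP => phif.
(* A mean within [- limit_fun f] of [limit_fun f] would be negative. *)
have phif' : 0 < - limit_fun f by rewrite oppr_gt0.
have [i [x [di _ xf _ _]]] := limit_fun_microstate 1%g phif' fc fc fc.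
have mean_ge0 : 0 <= empirical_mean x f.
  by rewrite mulr_ge0 ?invr_ge0// sumr_ge0.
by move: xf; rewrite ltr_distl => /andP[_]; lra.
Qed.

Let limit_fun1 : limit_fun (fun=> 1) = 1.
Proof.
apply: eq_close => e e0.
have c1 : continuous (fun _ : X => 1 : R) by move=> x; exact: cvg_cst.
have [i [x [di _ xf _ _]]] := limit_fun_microstate 1%g e0 c1 c1 c1.
have mean1 : empirical_mean x (fun=> 1) = 1.
  by rewrite /empirical_mean sumr_const card_ord mulVf// pnatr_eq0 -lt0n.
by rewrite distrC -[X in X - _]mean1 ltW.
Qed.

Definition limit_state : state R X := State limit_fun_lin limit_fun_ge0 limit_fun1.

(** Reindexing by the permutation [sigma i s] turns the mean of [f] into that of
    [f (x (sigma i s a))]. Comparing termwise with [f (act s (x a))] leaves the mean squared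
    distance, at most [delta ^+ 2] on microstates. *)
Lemma empirical_mean_shift (s : G) (e K delta : R) (f : X -> R) i (x : 'I_(d i) -> X) :
  (0 < d i)%N -> 0 <= K -> (forall y z, `|f y - f z| <= e + K * mdist y z ^+ 2) ->
  microstates act [fset s]%fset delta (@sigma i) x ->
  `|empirical_mean x (f \o act s) - empirical_mean x f| <= e + K * delta ^+ 2.
Proof.
move=> di K0 fK /bigmax0_ltP[d0 /(_ s)]; rewrite inE eqxx => /(_ isT).
set v := _ * _ => vd.
have v0 : 0 <= v.
  by rewrite mulr_ge0 ?invr_ge0// sumr_ge0// => a _; rewrite exprn_ge0 ?mdist_ge0.
have {vd} vd : v <= delta ^+ 2.
  by rewrite -(sqr_sqrtr v0) lerXn2r ?nnegrE ?sqrtr_ge0 ?ltW.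
apply: (@le_trans _ _ (e + K * v)); last by rewrite lerD2l ler_wpM2l.
have dR : 0 < (d i)%:R :> R by rewrite ltr0n.
rewrite /empirical_mean.
rewrite [X in _ - _ * X](reindex_inj (@perm_inj _ (sigma i s)))/=.
rewrite -mulrBr -sumrB normrM ger0_norm ?invr_ge0//.
rewrite [leRHS](_ : _ = (d i)%:R^-1 *
    \sum_(a < d i) (e + K * mdist (act s (x a)) (x (sigma i s a)) ^+ 2)).
  rewrite ler_wpM2l ?invr_ge0// (le_trans (ler_norm_sum _ _ _))//.
  by apply: ler_sum => a _; exact: fK.
rewrite big_split/= sumr_const card_ord mulrDr -mulr_sumr mulrCA -/v.
by rewrite -[e *+ _]mulr_natl mulKf ?gt_eqF.
Qed.

Lemma limit_state_invariant (s : G) (f : X -> R) : continuous f ->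
  limit_state (f \o act s) = limit_state f.
Proof.
move=> fc; apply: eq_close => e e0; have e4 : 0 < e / 4 by rewrite divr_gt0.
have [K K0 fK] := quadratic_modulus X_compact fc e4.
have fsc : continuous (f \o act s).
  by move=> x; apply: continuous_comp; [exact: (act_continuous act_cont)|exact: fc].
(* Four errors of at most [e / 4]: two mean approximations, the additive part of the modulus, and
   [K * delta ^+ 2 <= K * delta]. *)
pose delta := Order.min (e / 4) (Order.min 1 (e / 4 / K)).
have delta0 : 0 < delta by rewrite !lt_min e4 ltr01 divr_gt0.
have Kd : K * delta ^+ 2 <= e / 4.
  apply: (@le_trans _ _ (K * delta)).
    rewrite ler_wpM2l ?(ltW K0)// expr2 ler_piMr ?(ltW delta0)//.
    by rewrite !ge_min lexx orbT.
  by rewrite mulrC -ler_pdivlMr// !ge_min lexx !orbT.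
have de : delta <= e / 4 by rewrite ge_min lexx.
have [i [x [di xs xf xfs _]]] := limit_fun_microstate s delta0 fc fsc fc.
have := empirical_mean_shift di (ltW K0) fK xs.
move: xf xfs; rewrite /= !ltr_distl !ler_distl => /andP[? ?] /andP[? ?] /andP[? ?].
by apply/andP; split; lra.
Qed.

Lemma limit_state_measure : exists2 mu : borel_probability R X,
  invariant_probability R act mu & measure_entropy act sigma U mu = h.
Proof.
(* A microstate with [d i > 0] supplies the base point of the measure. *)
have [i [x [di _ _]]] := limit_mean_microstate 1%g [::] ltr01.
have [P [PE Pint]] := riesz X_compact limit_state (x (Ordinal di)).
(* The one-sided preimage bound, applied to [s] and to its inverse, gives equality. *)
have outer_inv s A : state_outer limit_state (act s @^-1` A) = state_outer limit_state A.
  have act_pre g B := @le_state_outer_preimage _ _ limit_state _ B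
    (act_continuous act_cont (g := g)) (limit_state_invariant g).
  apply/eqP; rewrite eq_le act_pre/=.
  have AE : act s^-1%g @^-1` (act s @^-1` A) = A.
    by apply/funext => y/=; rewrite -(actMx act_cont) mulgV (act1x act_cont).
  by rewrite -[X in (state_outer _ X <= _)%E]AE act_pre.
exists (BorelProbability P); first by move=> s A mA /=; rewrite !PE outer_inv.
apply/eqP; rewrite eq_le measure_entropy_le/=.
apply: le_ereal_inf_tmp => _ [L _ <-]; apply: le_ereal_inf_tmp => _ [F F0 <-].
apply: le_ereal_inf_tmp => _ [delta d0 <-].
(* Since integrals against [P] are values of [phi], microstates with mean near [phi] are microstates
   for the measure. *)
apply: le_trans (growth_rate_limit_mean L F0 d0) _.
apply: (growth_rate_le U_cover) => j y [yF yL]; split => //.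
apply/bigmax0_ltP; split => // f fL; rewrite /bmean Pint; last exact: cts_fun.
have -> : limit_state f = phi f.
  by rewrite /= (limit_funE (@cts_fun _ _ f)); congr (phi _); exact/continuousEP.
exact: yL.
Qed.

End limit_state.

End entropy.

Theorem theorem4p1 (R : realType) (G : groupType)
  (G_countable : countable [set: G])
  (d : nat -> nat) (sigma : forall i : nat, G -> {perm 'I_(d i)})
  (sigma_sofic : sofic_approximation R sigma)
  (X : metricType R) (X_compact : compact [set: X])
  (act : G -> X -> X) (act_cont : continuous_action act)
  (U : set (set X)) (U_cover : finite_open_cover U) :
  is_max [set measure_entropy act sigma U mu
           | mu in invariant_probability R act]
         (topological_entropy act sigma U).
Proof.
have d_oo := sofic_dim sigma_sofic.
have max_attained : (-oo < topological_entropy act sigma U)%E ->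
    exists2 mu, invariant_probability R act mu &
      measure_entropy act sigma U mu = topological_entropy act sigma U.
  move=> h_gtNy.
  have [phi phiP] := limit_mean d_oo U_cover X_compact h_gtNy.
  exact: limit_state_measure phiP.
split => [A0|[_ [mu mu_inv _]]].
  apply/eqP; rewrite -leeNy_eq leNgt; apply/negP => /max_attained[mu mu_inv mu_h].
  by have : set0 (measure_entropy act sigma U mu) by rewrite -A0; exists mu.
split; last by move=> _ [nu _ <-]; exact: measure_entropy_le.
have [/max_attained[nu nu_inv <-]|] := ltP -oo%E (topological_entropy act sigma U).
  by exists nu.
(* When the topological entropy is [-oo], any invariant measure attains it. *)
rewrite leeNy_eq => /eqP hNy; exists mu => //.
by apply/eqP; rewrite eq_le measure_entropy_le// hNy leNye.
Qed.
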